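(* Let $n\ge1$, let $\mathcal H\subset\mathbf{RP}^n$ be a finite subset and let $\langle w\rangle\in\mathbf{RP}^n$. Then $$\eta^{\bigstar}_n(\mathcal H\cup\{\langle w\rangle\})\ \le\ \sum_{\{\langle w_{i_1}\rangle,\dots,\langle w_{i_n}\rangle\}\subset\mathcal H}\eta^{\bigstar}_n\bigl(\{\langle w\rangle,\langle w_{i_1}\rangle,\dots,\langle w_{i_n}\rangle\}\bigr),$$ the sum being over all $n$-element subsets of $\mathcal H$.
   Context: $\mathbf{RP}^n$ is the set of $1$-dimensional subspaces of $\mathbf R^{n+1}$; for $v\ne0$ write $\langle v\rangle$ for the line it spans. Let $\mathcal H=\{\langle w_1\rangle,\dots,\langle w_T\rangle\}\subset\mathbf{RP}^n$ be a finite set of $T$ distinct points, and let an order on $\mathcal H$ be a bijection $\pi:[T]\to\mathcal H$, $\pi(i)=\langle w_i\rangle$. An ordered $n$-tuple $(\langle w_{i_1}\rangle,\dots,\langle w_{i_n}\rangle)$ of distinct elements of $\mathcal H$ satisfies the $\eta^\pi_n(\mathcal H)$ condition if (1) $2\le i_1<\dots<i_n\le T$, and (2) for every $l=1,\dots,n$, $\langle w_{i_l}\rangle$ is the $\pi$-minimal element among all points of $\mathcal H$ contained in $\mathrm{span}(w_{i_l},\dots,w_{i_n})$. Let $B^\pi(\mathcal H)$ be the set of such tuples with $w_{i_1},\dots,w_{i_n}$ linearly independent. It is a known fact that $|B^\pi(\mathcal H)|$ does not depend on $\pi$; this common value is denoted $\eta^{\bigstar}_n(\mathcal H)$. *)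

(* Defs.v *)
(* MathComp, with the real numbers as an abstract realType. *)
From HB Require Import structures.
From mathcomp Require Import all_boot all_order all_algebra finmap reals.

Set Implicit Arguments.
Unset Strict Implicit.
Unset Printing Implicit Defensive.

Import GRing.Theory.
Local Open Scope ring_scope.
Local Open Scope fset_scope.

Definition RP (R : realType) (n : nat) :=
  {U : {vspace 'rV[R]_n.+1} | \dim U == 1%N}.

(* A chosen nonzero vector w spanning the line x, see line_repr_vec. *)
Definition repr_vec (R : realType) (n : nat) (x : RP R n) : 'rV[R]_n.+1 :=
  vpick (val x).

Lemma line_repr_vec (R : realType) (n : nat) (x : RP R n) :
  <[repr_vec x]>%VS = val x.
Proof.
apply/eqP; rewrite eqEdim -memvE memv_pick dim_vline vpick0.
by case: x => U /= dU; rewrite -dimv_eq0 (eqP dU).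
Qed.

Section Eta.
Variables (R : realType) (n : nat) (H : {fset RP R n}).
Implicit Types (pi : 'I_#|{: H}| -> H) (i : n.-tuple 'I_#|{: H}|).

(* An order on H is a bijection pi; i holds the indices (i_1, ..., i_n). *)
Definition tail_span pi i (l : 'I_n) : {vspace 'rV[R]_n.+1} :=
  <<[seq repr_vec (val (pi j)) | j <- drop l i]>>%VS.

(* Indices start at 0, so 2 <= i_1 < ... < i_n becomes 0 < i_1 < ... < i_n. *)
Definition eta_cond pi i : bool :=
  path ltn 0%N [seq val j | j <- i] &&
  [forall l : 'I_n, forall j : 'I_#|{: H}|,
     (val (val (pi j)) <= tail_span pi i l)%VS ==> (tnth i l <= j)%N].

Definition B_set pi : {set n.-tuple H} :=
  [set [tuple of map pi i] | i : n.-tuple 'I_#|{: H}| &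
     eta_cond pi i && free [seq repr_vec (val (pi j)) | j <- i]].

(* The cardinality is the same for every order (card_B_set below), so the
   enumeration enum_val of H serves as the order. *)
Definition eta_star : nat := #|B_set enum_val|.

End Eta.

(* Independence of the order: the count is rewritten as the number of no broken
   circuit bases, which satisfies the deletion-contraction recursion nbc_num. *)
Section NbcCount.
Variables (K : fieldType) (V : vectType K).
Implicit Types (s t : seq V) (U : {vspace V}) (a b : V).

Fixpoint nbc_num s U (m : nat) : nat :=
  if s is a :: s' then
    if a \in U then 0%N else
    (nbc_num s' U m + if m is m'.+1 then nbc_num s' (U + <[a]>) m' else 0)%N
  else m == 0%N.

Lemma exchange U a b : a \notin U -> a \in (U + <[b]>)%VS ->
  (U + <[a]> = U + <[b]>)%VS.
Proof.
move=> aU aUb; apply/eqP; rewrite eqEdim.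
rewrite subv_add addvSl -memvE aUb /=.
have dU : (\dim U < \dim (U + <[a]>))%N.
  rewrite ltnNge; apply: contra aU => le.
  have /eqP-> : U == (U + <[a]>)%VS by rewrite eqEdim addvSl.
  by rewrite memvE addvSr.
apply: leq_trans dU; apply: leq_trans (dimv_add_leqif _ _).1 _.
by rewrite dim_vline -addn1 leq_add2l; case: (b == 0).
Qed.

Lemma exchange_in U a b : a \notin U -> a \in (U + <[b]>)%VS ->
  b \in (U + <[a]>)%VS.
Proof. by move=> aU /(exchange aU)->; rewrite memvE addvSr. Qed.

Lemma nbc_num_swap a b s U m :
  nbc_num (a :: b :: s) U m = nbc_num (b :: a :: s) U m.
Proof.
have sub x y : x \in U -> x \in (U + <[y]>)%VS.
  by move=> xU; apply: subvP xU; exact: addvSl.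
rewrite /=; case: (boolP (a \in U)) => aU; case: (boolP (b \in U)) => bU //.
- by case: m => // m; rewrite sub.
- by case: m => // m; rewrite sub.
case: m => [|m] //.
have -> : (a \in (U + <[b]>)%VS) = (b \in (U + <[a]>)%VS).
  by apply/idP/idP; exact: exchange_in.
case: (boolP (b \in (U + <[a]>)%VS)) => [bUa|_].
  by rewrite (exchange bU bUa).
rewrite -!addnA; congr addn; rewrite [RHS]addnCA; congr addn; congr addn.
by case: m => // m; rewrite -!addvA (addvC <[b]>%VS).
Qed.

Lemma nbc_num_cons a s t U m :
    (forall U m, nbc_num s U m = nbc_num t U m) ->
  nbc_num (a :: s) U m = nbc_num (a :: t) U m.
Proof. by move=> E /=; case: m => [|m]; rewrite !E. Qed.

Lemma nbc_num_perm s t U m : perm_eq s t -> nbc_num s U m = nbc_num t U m.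
Proof.
elim: s t U m => [|a s IHs] t U m; first by rewrite perm_sym => /perm_nilP->.
move=> st; have at_ : a \in t by rewrite -(perm_mem st) mem_head.
case/path.splitPr: t / at_ st => t1 t2.
rewrite perm_sym perm_catC cat_cons perm_cons perm_catC perm_sym => st.
have -> : nbc_num (a :: s) U m = nbc_num (a :: t1 ++ t2) U m.
  by apply: nbc_num_cons => U' m'; apply: IHs.
elim: t1 U m {st} => // b t1 IHt U m.
by rewrite [RHS](@nbc_num_cons _ _ (a :: t1 ++ t2)) // nbc_num_swap.
Qed.

Variable v : nat -> V.
Implicit Type S : seq nat.

Definition nbc_seq k U S :=
  [/\ path ltn 0%N S, all (leq^~ k) S &
   forall l j, (l <= size S)%N -> (j <= k)%N ->
     v j \in (U + <<map v (drop l S)>>)%VS -> (l < size S)%N /\ (nth 0%N S l <= j)%N].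

Fixpoint nbc_enum k U m : seq (seq nat) :=
  if k is k'.+1 then
    if v k \in U then [::] else
    nbc_enum k' U m ++
    if m is m'.+1 then [seq rcons q k | q <- nbc_enum k' (U + <[v k]>) m']
    else [::]
  else if (v 0%N \notin U) && (m == 0%N) then [:: [::]] else [::].

Let irr m : (m < m)%N -> False.
Proof. by rewrite ltnn. Qed.

Lemma nbc_enum_sound k U m S : S \in nbc_enum k U m ->
  size S = m /\ nbc_seq k U S.
Proof.
elim: k U m S => [|k IHk] U m S /=.
  case: (boolP (v 0%N \in U)) => //= v0; case: eqP => //= ->.
  rewrite inE => /eqP->; split=> //; split=> // l j; rewrite !leqn0.
  by move=> /eqP-> /eqP->; rewrite span_nil addv0 (negPf v0).
case: (boolP (v k.+1 \in U)) => // vU; rewrite mem_cat => /orP[].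
  move=> /IHk[Sm [pS aS cS]]; split=> //; split=> //.
    by apply: sub_all aS => x /= /leqW.
  move=> l j lS; rewrite leq_eqVlt => /orP[/eqP->|/(cS _ _ lS)//].
  move: lS; rewrite leq_eqVlt => /orP[/eqP->|lS _].
    by rewrite drop_size span_nil addv0 (negPf vU).
  by split=> //; apply: leqW; have /allP := aS; apply; exact: mem_nth.
case: m => // m /mapP[S' /IHk[Sm [pS aS cS]] ->].
rewrite size_rcons Sm; split=> //; split.
- rewrite rcons_path pS /=; case/lastP: S' aS {Sm pS cS} => // S' x.
  by rewrite all_rcons last_rcons ltnS => /andP[].
- by rewrite all_rcons leqnn /=; apply: sub_all aS => x /= /leqW.
move=> l j; rewrite size_rcons leq_eqVlt => /orP[/eqP->|].
  rewrite drop_oversize ?size_rcons // span_nil addv0.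
  rewrite leq_eqVlt => /orP[/eqP->|jk vj]; first by rewrite (negPf vU).
  have vj' : v j \in (U + <[v k.+1]> + <<map v (drop (size S') S')>>)%VS.
    by rewrite drop_size span_nil addv0; apply: subvP vj; exact: addvSl.
  by have [/irr] := cS (size S') j (leqnn _) jk vj'.
rewrite ltnS => lS; rewrite drop_rcons // map_rcons.
have -> : <<rcons (map v (drop l S')) (v k.+1)>>%VS =
    (<[v k.+1]> + <<map v (drop l S')>>)%VS.
  by rewrite -span_cons; apply: eq_span => x; rewrite mem_rcons.
rewrite addvA lS => jk vj; split=> //; rewrite nth_rcons.
move: jk; rewrite leq_eqVlt => /orP[/eqP->|jk].
  case: ltnP => [lS'|]; last by case: ifP.
  by apply: leqW; have /allP := aS; apply; exact: mem_nth.
by have [-> ] := cS l j lS jk vj.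
Qed.

Lemma nbc_enum_complete k U m S : size S = m -> nbc_seq k U S ->
  S \in nbc_enum k U m.
Proof.
elim: k U m S => [|k IHk] U m S /= Sm [pS aS cS].
  have S0 : S = [::].
    case: S pS aS {Sm cS} => //= x S /andP[x0 _] /andP[].
    by rewrite leqn0; case: x x0.
  rewrite -Sm S0 /= andbT; case: (boolP (v 0%N \in U)) => //= v0.
  have [] := cS 0%N 0%N isT isT; last by rewrite S0.
  by rewrite S0 span_nil addv0.
case: (boolP (v k.+1 \in U)) => vU.
  have vj' : v k.+1 \in (U + <<map v (drop (size S) S)>>)%VS.
    by rewrite drop_size span_nil addv0.
  by have [/irr] := cS (size S) k.+1 (leqnn _) (leqnn _) vj'.
rewrite mem_cat; apply/orP.
have [Sk|] := boolP (all (leq^~ k) S).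
  by left; apply: IHk => //; split=> // l j lS jk; apply: cS => //; exact: leqW.
case/lastP: S Sm pS aS cS => // S x; rewrite size_rcons => <- pS aS cS nS.
have Sx : all (ltn^~ x) S.
  move: pS; rewrite -cats1 cat_path /= => /and3P[pS xS _].
  move: pS; rewrite -[path _ _ _]/(sorted ltn (0%N :: S)).
  case/lastP: S xS {aS cS nS} => // S y; rewrite last_rcons => yx.
  rewrite -rcons_cons -cats1 (sorted_pairwise ltn_trans) pairwise_cat allrel1r.
  move=> /andP[/andP[_ /allP Sy] _]; apply/allP => z; rewrite mem_rcons inE => /orP[/eqP->//|zS].
  exact: ltn_trans (Sy z zS) yx.
have xk : x = k.+1.
  move: aS; rewrite all_rcons => /andP[xk _]; apply/eqP; rewrite eqn_leq xk ltnNge.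
  apply: contra nS => xk'; rewrite all_rcons xk' /=.
  by apply: sub_all Sx => z /= /ltnW /leq_trans; apply.
right; rewrite {}xk in pS aS cS nS Sx *; apply: map_f; apply: IHk => //.
split=> //; first by move: pS; rewrite rcons_path => /andP[].
move=> l j lS jk vj; have := cS l j; rewrite drop_rcons // map_rcons.
have -> : <<rcons (map v (drop l S)) (v k.+1)>>%VS =
    (<[v k.+1]> + <<map v (drop l S)>>)%VS.
  by rewrite -span_cons; apply: eq_span => x'; rewrite mem_rcons.
rewrite addvA => /(_ (leqW lS) (leqW jk) vj)[_]; rewrite nth_rcons.
case: ltnP => // lS'; case: eqP => [_|/eqP]; last by rewrite eqn_leq lS lS'.
by rewrite leqNgt ltnS jk.
Qed.

Lemma nbc_enum_uniq k U m : uniq (nbc_enum k U m).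
Proof.
elim: k U m => [|k IHk] U m /=; first by case: ifP.
case: ifP => // _; rewrite cat_uniq IHk /=; case: m => // m.
rewrite (map_inj_uniq (@rcons_injl _ _)) IHk andbT.
apply/hasPn => _ /mapP[S _ ->] /=; apply/negP => /nbc_enum_sound[_ [_]].
by rewrite all_rcons ltnn.
Qed.

Lemma size_nbc_enum k U m : (\dim U + m.+1 = \dim {:V})%N ->
  size (nbc_enum k U m) = nbc_num [seq v i | i <- rev (iota 0 k.+1)] U m.+1.
Proof.
elim: k U m => [|k IHk] U m dU.
  by rewrite /=; case: (boolP (v 0%N \in U)) => //= _; case: m {dU}.
have -> : [seq v i | i <- rev (iota 0 k.+2)] =
    v k.+1 :: [seq v i | i <- rev (iota 0 k.+1)].
  by rewrite -(addn1 k.+1) iotaD rev_cat.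
set s := [seq v i | i <- _] in IHk *.
cbn [nbc_enum nbc_num]; case: ifP => // vU; rewrite size_cat IHk //; congr addn.
have dUv : (\dim (U + <[v k.+1]>) = (\dim U).+1)%N.
  rewrite dimv_disjoint_sum ?dim_vline; last first.
    apply/eqP; rewrite -subv0; apply/subvP => x; rewrite memv_cap.
    case/andP => xU /vlineP[c xc]; rewrite memv0; apply/eqP.
    have [c0|c0] := eqVneq c 0; first by rewrite xc c0 scale0r.
    by have := memvZ c^-1 xU; rewrite xc scalerA mulVf // scale1r vU.
  have : v k.+1 != 0 by apply: contraFneq vU => ->; exact: mem0v.
  by move=> ->; rewrite addn1.
case: m dU => [|m] dU; last by rewrite size_map IHk // dUv addSnnS.
have -> : (U + <[v k.+1]> = fullv)%VS.
  by apply/eqP; rewrite eqEdim subvf dUv -dU addn1 leqnn.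
rewrite /s -(addn1 k) iotaD rev_cat.
by cbn [map rev catrev cat iota nbc_num]; rewrite /= memvf.
Qed.

End NbcCount.

Section Indep.
Variables (R : realType) (n : nat) (H : {fset RP R n}).

Lemma repr_vec_neq0 (x : RP R n) : repr_vec x != 0.
Proof. by rewrite vpick0; case: x => U /= dU; rewrite -dimv_eq0 (eqP dU). Qed.

Lemma card_B_setE (pi : 'I_#|{: H}| -> H) : (0 < n)%N -> bijective pi ->
  #|B_set pi| = nbc_num [seq repr_vec (val x) | x <- enum {: H}] 0%VS n.+1.
Proof.
move=> n_gt0 bij_pi; have inj_pi := bij_inj bij_pi.
rewrite card_in_imset; last first.
  move=> i j _ _ /(congr1 val) /= /(inj_map inj_pi) ij; exact: val_inj.
have [T0|T_gt0] := posnP #|{: H}|.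
  have -> : enum {: H} = [::] by apply: size0nil; rewrite -cardT.
  rewrite /= eq_card0 // => i.
  have lt := ltn_ord (tnth i (Ordinal n_gt0)).
  by have := leq_trans lt (eq_leq T0).
pose s := [seq repr_vec (val (pi j)) | j <- enum 'I_#|{: H}|].
pose v k := nth 0 s k.
have sz : size s = #|{: H}| by rewrite size_map size_enum_ord.
have vE (j : 'I_#|{: H}|) : v j = repr_vec (val (pi j)).
  by rewrite /v (nth_map j) ?size_enum_ord // nth_ord_enum.
have sE : perm_eq [seq v i | i <- rev (iota 0 #|{: H}|.-1.+1)]
                  [seq repr_vec (val x) | x <- enum {: H}].
  rewrite map_rev perm_rev prednK // -sz map_nth_iota0 // take_size.
  rewrite /s (map_comp (fun x => repr_vec (val x)) pi); apply: perm_map.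
  apply: uniq_perm; rewrite ?(map_inj_uniq inj_pi) ?enum_uniq // => x.
  case: bij_pi => g _ gK; rewrite [RHS]mem_enum; apply/mapP; exists (g x) => //.
  by rewrite mem_enum.
rewrite -(nbc_num_perm _ _ sE) -size_nbc_enum; last by rewrite dimv0 dimvf /dim /= mul1n.
rewrite cardE -(size_map (fun i : n.-tuple _ => [seq val j | j <- i])).
apply: perm_size; apply: uniq_perm.
- rewrite map_inj_uniq ?enum_uniq // => i j /(inj_map val_inj) ij; exact: val_inj.
- exact: nbc_enum_uniq.
have mapE (i : n.-tuple 'I_#|{: H}|) l : map v (drop l [seq val j | j <- i]) =
    [seq repr_vec (val (pi j)) | j <- drop l i].
  by rewrite -map_drop -map_comp; apply: eq_map => j /=; exact: vE.
have leT k : (k <= #|{: H}|.-1)%N = (k < #|{: H}|)%N.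
  by rewrite -ltnS prednK.
move=> S; apply/mapP/idP => [[i]|].
  rewrite mem_enum inE => /andP[/andP[pS /forallP cS] _] ->.
  apply: nbc_enum_complete; first by rewrite size_map size_tuple.
  split=> //.
    by apply/allP => _ /mapP[j _ ->]; rewrite leT ltn_ord.
  move=> l j; rewrite size_map size_tuple mapE add0v leT.
  move=> ln jT; rewrite -[j]/(val (Ordinal jT)) vE; move: ln.
  rewrite leq_eqVlt => /orP[/eqP->|ln].
    by rewrite drop_oversize ?size_tuple // span_nil memv0 (negPf (repr_vec_neq0 _)).
  move=> vj; split=> //; have /forallP/(_ (Ordinal jT)) := cS (Ordinal ln).
  rewrite -line_repr_vec -memvE vj /= (nth_map (Ordinal jT)) ?size_tuple //.
  by rewrite (tnth_nth (Ordinal jT)).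
move=> /nbc_enum_sound[Sn [pS aS cS]].
pose j0 := Ordinal T_gt0; pose i0 := [seq insubd j0 k | k <- S].
have i0K : [seq val j | j <- i0] = S.
  rewrite -map_comp map_id_in // => k kS /=; rewrite val_insubd.
  by have /allP/(_ k kS) := aS; rewrite leT => ->.
have si : size i0 == n by rewrite size_map Sn.
exists (Tuple si) => //; rewrite mem_enum inE -andbA.
have mapE' l : map v (drop l S) = [seq repr_vec (val (pi j)) | j <- drop l i0].
  by rewrite -(mapE (Tuple si)) /= i0K.
rewrite /eta_cond /= i0K pS /=; apply/andP; split.
  apply/forallP => l; apply/forallP => j; apply/implyP.
  rewrite -line_repr_vec -memvE /tail_span /= -mapE' -vE => vj.
  have [] := cS l j; rewrite ?add0v ?Sn //; first exact: ltnW.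
    by rewrite leT.
  by rewrite (tnth_nth j0) /= -[S in nth 0%N S]i0K (nth_map j0) // (eqP si).
have := mapE' 0; rewrite !drop0 => <-.
suff fr k : (k <= size S)%N -> free (map v (drop (size S - k) S)).
  by have := fr _ (leqnn _); rewrite subnn drop0.
elim: k => [|k IHk] kS; first by rewrite subn0 drop_size nil_free.
have lt : (size S - k.+1 < size S)%N by rewrite ltn_subrL; case: (size S) kS.
rewrite (drop_nth 0%N) // map_cons free_cons -subSn // subSS IHk ?(ltnW kS) // andbT.
apply/negP => vin.
have xS := mem_nth 0 lt; have := cS (size S - k)%N (nth 0%N S (size S - k.+1)%N).
rewrite add0v leq_subr => /(_ isT (allP aS _ xS) vin)[lt' le'].
have /= := pS; rewrite -[path _ _ _]/(sorted ltn (0%N :: S)) => /path_sorted so.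
have lk : (size S - k.+1 < size S - k)%N by rewrite subnS prednK // subn_gt0.
have := @sorted_ltn_nth _ ltn ltn_trans 0%N S so _ _ lt lt' lk.
by move=> /leq_trans/(_ le'); rewrite ltnn.
Qed.

Lemma card_B_set (pi : 'I_#|{: H}| -> H) : (0 < n)%N -> bijective pi ->
  #|B_set pi| = eta_star H.
Proof.
move=> n_gt0 bij_pi; rewrite /eta_star !card_B_setE //; exact: enum_val_bij.
Qed.

End Indep.

(* Main.v *)
(* Order the points with w first: w then plays no role in the tuples counted by
   the left-hand side, each of which is determined by its underlying n-subset S
   of H and remains admissible after deleting from H every point outside S.  On
   the counting function nbc_num, whose list is the order read backwards, this is
   an induction on H along the deletion-contraction recursion, with w kept at the
   end of the list. *)
Require Import Defs.
From mathcomp Require Import all_boot all_order all_algebra finmap reals.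
Local Open Scope fset_scope.

Set Implicit Arguments.
Unset Strict Implicit.
Unset Printing Implicit Defensive.

(** Subsets avoiding [a] will match the deletion term of [nbc_num], those containing [a] the
    contraction term. *)
Lemma fpowersetU1_perm (T : choiceType) (a : T) (X : {fset T}) : a \notin X ->
  perm_eq (fpowerset (a |` X))
          (fpowerset X ++ [seq a |` Y | Y <- fpowerset X]).
Proof.
move=> aX; have aS Y : Y `<=` X -> a \notin Y.
  by move=> SX; apply: contra aX; apply: (fsubsetP SX).
apply: uniq_perm; first exact: fset_uniq.
  rewrite cat_uniq fset_uniq map_inj_in_uniq ?fset_uniq ?andbT /=.
    apply/hasPn => _ /mapP[Y _ ->]; rewrite -[X in ~~ X]/(_ \in fpowerset X).
    rewrite fpowersetE; apply: contra aX => /fsubsetP; apply.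
    exact: fset1U1.
  move=> Y Y' /=; rewrite !fpowersetE => /aS aS1 /aS aS2 E.
  by rewrite -(fsetU1K aS1) E fsetU1K.
move=> Y; rewrite mem_cat fpowersetE [in RHS]fpowersetE.
apply/idP/orP => [SaX|[SX|/mapP[Y']]].
- have [aS'|aS'] := boolP (a \in Y).
    right; apply/mapP; exists (Y `\ a); last by rewrite fsetD1K.
    by rewrite fpowersetE fsubDset.
  by left; rewrite -(mem_fsetD1 aS') fsubDset.
- exact: fsubset_trans SX (fsubsetU1 _ _).
- by rewrite fpowersetE => SX ->; apply: fsetUS.
Qed.

(** Contractions only enlarge [U], so every branch that reaches [w] finds it in the current subspace
    and contributes 0. *)
Lemma nbc_num_last_mem (K : fieldType) (V : vectType K) (s : seq V) (w : V)
    (U : {vspace V}) (m : nat) :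
  w \in U -> nbc_num (rcons s w) U m = 0%N.
Proof.
elim: s U m => [|a s IHs] U m wU /=; first by rewrite wU.
case: ifP => // _; rewrite IHs //; case: m => // m; rewrite IHs //.
by apply: subvP wU; apply: addvSl.
Qed.

(* The codimension bound kills the contraction terms at m = 0, which no subset Y
   of size 0 could account for. *)
Lemma nbc_num_le_sum (K : fieldType) (V : vectType K) (T : choiceType)
    (f : T -> V) (w : V) (X : {fset T}) (U : {vspace V}) (m : nat) :
  (\dim {:V} <= \dim U + m.+1)%N ->
  (nbc_num (rcons [seq f x | x <- X] w) U m.+1 <=
     \sum_(Y <- fpowerset X | #|` Y| == m)
        nbc_num (rcons [seq f x | x <- Y] w) U m.+1)%N.
Proof.
elim/fset1U_rect: X U m => [|a X aX IHX] U m dU.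
  rewrite fpowerset0 big_mkcond big_seq_fset1 cardfs0.
  have -> : enum_fset fset0 = [::] :> seq T by apply/eqP; rewrite -size_eq0 cardfs0.
  (* For positive [m] the one-vector list is too short for [m.+1] contractions. *)
  by case: m dU => [|m] dU //=; case: ifP.
(* The enumeration of a finite set has no prescribed order; permutation invariance brings [f a] to
   the head, where the recursion acts. *)
have consE (Y : {fset T}) : a \notin Y ->
    nbc_num (rcons [seq f x | x <- a |` Y] w) =2
    nbc_num (f a :: rcons [seq f x | x <- Y] w).
  move=> aS U' m'; apply: nbc_num_perm; rewrite -rcons_cons -map_cons -!cats1.
  rewrite perm_cat2r; apply: perm_map; apply: uniq_perm.
  - exact: fset_uniq.
  - by rewrite /= aS fset_uniq.
  - by move=> x; rewrite !inE.
have aS Y : Y \in fpowerset X -> a \notin Y.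
  by rewrite fpowersetE => SX; apply: contra aX; apply: (fsubsetP SX).
rewrite consE //=; case: ifP => // /negbT faU.
rewrite (perm_big _ (fpowersetU1_perm aX)) big_cat big_map /=.
apply: leq_add; first exact: IHX.
have dUa : (\dim U < \dim (U + <[f a]>))%N.
  rewrite (ltn_leqif (dimv_leqif_sup (addvSl _ _))).
  by apply: contra faU => /subvP; apply; rewrite memvE addvSr.
case: m dU => [|m] dU.
  rewrite nbc_num_last_mem //; suff /eqP-> : (U + <[f a]> == fullv)%VS by exact: memvf.
  by rewrite eqEdim subvf (leq_trans dU) // addn1.
(* Contracting by [f a] raises the dimension, so the codimension bound survives with one vector
   fewer to choose. *)
apply: leq_trans (IHX _ m _) _.
  by apply: leq_trans dU _; rewrite addnS -addSn leq_add2r.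
rewrite big_mkcond [leqRHS]big_mkcond big_seq [leqRHS]big_seq.
apply: leq_sum => Y /aS aY; rewrite cardfsU1 aY add1n eqSS; case: ifP => // _.
by rewrite consE //= (negPf faU) leq_addl.
Qed.

Lemma eta_starE (R : realType) (n : nat) (X : {fset RP R n}) : (0 < n)%N ->
  eta_star X = nbc_num [seq repr_vec x | x <- X] 0%VS n.+1.
Proof.
move=> n_gt0; rewrite /eta_star card_B_setE //; last exact: enum_val_bij.
by rewrite (map_comp (@repr_vec R n) val) -enum_fsetE.
Qed.

Lemma eta_star_fsetU1 (R : realType) (n : nat) (X : {fset RP R n}) w :
  (0 < n)%N -> w \notin X ->
  eta_star (w |` X) = nbc_num (rcons [seq repr_vec x | x <- X] (repr_vec w)) 0%VS n.+1.
Proof.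
move=> n_gt0 wX; rewrite eta_starE //; apply: nbc_num_perm.
rewrite -map_rcons; apply: perm_map; apply: uniq_perm.
- exact: fset_uniq.
- by rewrite rcons_uniq wX fset_uniq.
- by move=> x; rewrite mem_rcons !inE.
Qed.

Theorem theorem2 (R : realType) (n : nat) (H : {fset RP R n}) (w : RP R n) :
  (1 <= n)%N ->
  (eta_star (w |` H) <=
     \sum_(S <- fpowerset H | #|` S| == n) eta_star (w |` S))%N.
Proof.
(* Removing [w] from [H] first ensures that it occurs once in the list, at the end. *)
move=> n_gt0; have -> : w |` H = w |` (H `\ w).
  have [wH|wH] := boolP (w \in H); last by rewrite mem_fsetD1.
  by rewrite mem_fset1U // fsetD1K.
rewrite eta_star_fsetU1 ?fsetD11 //.
apply: leq_trans (nbc_num_le_sum _ _ _ _) _.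
  by rewrite dimv0 dimvf /dim /= mul1n.
apply: (@leq_trans (\sum_(S <- fpowerset (H `\ w) | #|` S| == n) eta_star (w |` S))%N).
  rewrite big_seq_cond [leqRHS]big_seq_cond; apply: leq_sum => Y /andP[].
  rewrite fpowersetE fsubsetD1 => /andP[_ wY] _.
  by rewrite eta_star_fsetU1.
(* The subsets of [H] that contain [w] only add nonnegative terms. *)
apply: (uniq_sub_le_big leqnn (fun i j => leq_addr j i)); try exact: fset_uniq.
by apply/fsubsetP; rewrite fpowersetS fsubD1set.
Qed.
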